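(* Assume (A1)–(A5) of the context, and let $\{\bm{x}_{i,t}\}_{t=1}^T$, $i\in[m]$, be generated by Algorithm ODCMD with $$\eta=\frac{1}{\sqrt T},\qquad \rho_t=\mathcal O\Big(\frac{1}{t^{3/2}}\Big),\quad t\in[T].$$ Then, for all $T\ge1$ and any $j\in[m]$, $$\overline{\mathrm{Reg}}_j(T)=\mathcal O\big(1/\sqrt T\big).$$
   Context: Notation: $[m]=\{1,\dots,m\}$; $\|\cdot\|$ is a norm on $\mathbb R^d$ with dual norm $\|\bm x\|_*=\max_{\|\bm y\|=1}\langle \bm x,\bm y\rangle$; $\nabla f(\bm x)$ denotes any (sub)gradient of $f$ at $\bm x$. For positive sequences, $a_t=\mathcal O(b_t)$ means $\limsup_{t\to\infty}a_t/b_t<\infty$; the horizon is $T$, the algorithm is run with the stated parameters for each $T$, and the constant implied in $\rho_t=\mathcal O(t^{-3/2})$ does not depend on $t$ or $T$. Problem: $\mathcal K\subseteq\mathbb R^d$ is a convex constraint set, $\ell_{i,t}:\mathbb R^d\to\mathbb R$ is the convex loss function of node $i\in[m]$ at round $t\in[T]$, and $r$ is a convex, possibly nonsmooth, regularization function. Let $\bm x^\star=\arg\min_{\bm x\in\mathcal K}\sum_{t=1}^T\sum_{j=1}^m(\ell_{j,t}(\bm x)+r(\bm x))$. The average regularized regret of node $i$ over $T$ rounds is $$\overline{\mathrm{Reg}}_i(T)=\frac1T\sum_{t=1}^T\sum_{j=1}^m(\ell_{j,t}(\bm x_{i,t})+r(\bm x_{i,t}))-\frac1T\sum_{t=1}^T\sum_{j=1}^m(\ell_{j,t}(\bm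 x^\star)+r(\bm x^\star)).$$ Network: $\mathcal G_t=(\mathcal V,\mathcal E_t)$ with $\mathcal V=[m]$, weight matrix $\bm P(t)\in\mathbb R^{m\times m}$, and $\mathcal E_t=\{\{i,j\}: [\bm P(t)]_{ij}>0\}$. Bregman divergence: for a function $\omega:\mathbb R^d\to\mathbb R$, $V_\omega(\bm x,\bm y)=\omega(\bm x)-\omega(\bm y)-\langle\nabla\omega(\bm y),\bm x-\bm y\rangle$. Assumptions (all constants are independent of $T$). (A1) (a) $\bm P(t)$ is doubly stochastic for all $t\ge1$; (b) there is $\zeta>0$ such that $[\bm P(t)]_{ii}\ge\zeta$ for all $i$ and $t\ge1$, and $[\bm P(t)]_{ij}\ge\zeta$ if $\{i,j\}\in\mathcal E_t$; (c) there is an integer $B\ge1$ such that the graph $(\mathcal V,\mathcal E_{kB+1}\cup\dots\cup\mathcal E_{(k+1)B})$ is strongly connected for all $k\ge0$. (A2) $\|\bm x-\bm y\|\le D_{\mathcal K}$ for all $\bm x,\bm y\in\mathcal K$. (A3) Each $\ell_{i,t}$ is $G_\ell$-Lipschitz over $\mathcal K$ with respect to $\|\cdot\|$ (so that $\|\nabla\ell_{i,t}(\bm x)\|_*\le G_\ell$ for $\bm x\in\mathcal K$), and $r$ is $G_r$-Lipschitz over $\mathcal K$ with respect to $\|\cdot\|$. (A4) $\omega$ is $\sigma_\omega$-strongly convex on $\mathcal K$ with respect to $\|\cdot\|$, i.e. $\omega(\bm x)\ge\omega(\bm y)+\langle\nabla\omega(\bm y),\bm x-\bm y\rangle+\frac{\sigma_\omega}{2}\|\bm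 x-\bm y\|^2$, and $\|\nabla\omega(\bm x)-\nabla\omega(\bm y)\|_*\le G_\omega\|\bm x-\bm y\|$, for all $\bm x,\bm y\in\mathcal K$. (A5) $V_\omega(\bm x,\cdot)$ is convex in its second argument for every fixed $\bm x$, i.e. $V_\omega(\bm x,\sum_i\alpha_i\bm y_i)\le\sum_i\alpha_iV_\omega(\bm x,\bm y_i)$ for convex weights $\alpha_i$. Algorithm ODCMD (step size $\eta>0$, errors $\rho_t\ge0$): initialize $\bm x_{i,1}=\arg\min_{\bm x\in\mathcal K}\omega(\bm x)$ for $i\in[m]$. For $t=1,\dots,T$, each node $i$ receives $\nabla_{i,t}=\nabla\ell_{i,t}(\bm x_{i,t})$; with $F_{i,t}(\bm x)=\langle\nabla_{i,t},\bm x\rangle+r(\bm x)+\frac1\eta V_\omega(\bm x,\bm x_{i,t})$ and $\bm y_{i,t}^\star=\arg\min_{\bm x\in\mathcal K}F_{i,t}(\bm x)$, it computes some $\bm y_{i,t}\in\mathcal K$ with $F_{i,t}(\bm y_{i,t})\le F_{i,t}(\bm y_{i,t}^\star)+\rho_t$ (a $\rho_t$-approximate solution), and sets $\bm x_{i,t+1}=\sum_{j=1}^m[\bm P(t)]_{ij}\bm y_{j,t}$. *)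

(* Defs.v *)
From HB Require Import structures.
From mathcomp Require Import all_boot all_order all_algebra.
From mathcomp Require Import all_classical all_reals all_analysis.

(* MathComp-Analysis; R^d is 'rV[R]_d.  Rounds are numbered from 1 (index 0 of
   a time-indexed sequence is never used) and nodes are elements of 'I_m. *)

Set Implicit Arguments.
Unset Strict Implicit.
Unset Printing Implicit Defensive.

Import Order.TTheory GRing.Theory Num.Theory.

Local Open Scope classical_set_scope.
Local Open Scope ring_scope.

Section Geometry.
Variables (R : realType) (d : nat).
Implicit Types (N f : 'rV[R]_d -> R) (K D : set 'rV[R]_d) (x y g : 'rV[R]_d).

(* An arbitrary norm on R^d; the canonical norm of 'rV[R]_d is only the
   supremum norm. *)
Definition is_norm N :=
  [/\ forall x, 0 <= N x,
      forall x, N x = 0 -> x = 0,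
      forall (a : R) x, N (a *: x) = `|a| * N x
    & forall x y, N (x + y) <= N x + N y].

Definition dotp x y : R := \sum_(k < d) x ord0 k * y ord0 k.

(* The supremum is a maximum, the unit sphere of N being compact. *)
Definition dual_norm N x : R := sup [set dotp x y | y in [set y | N y = 1]].

Definition is_argmin K f x := K x /\ forall z, K z -> f x <= f z.

Definition lipschitz_over K N (G : R) f :=
  forall x y, K x -> K y -> `|f x - f y| <= G * N (x - y).

(* D = setT gives the usual subgradients of f : R^d -> R. *)
Definition subgradient D f x g := forall z, D z -> f x + dotp g (z - x) <= f z.

(* dw x is the chosen (sub)gradient of w at x. *)
Definition bregman (w : 'rV[R]_d -> R) (dw : 'rV[R]_d -> 'rV[R]_d) x y : R :=
  w x - w y - dotp (dw y) (x - y).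

End Geometry.

Section Assumptions.
Variables (R : realType) (m d : nat).

Definition doubly_stochastic (A : 'M[R]_m) :=
  [/\ forall i j, 0 <= A i j,
      forall i, \sum_j A i j = 1
    & forall j, \sum_i A i j = 1].

(* Edges are ordered pairs.  P t need not be symmetric; reading edges as
   unordered pairs would make the network assumption more restrictive. *)
Definition edge (P : nat -> 'M[R]_m) (t : nat) : rel 'I_m :=
  [rel i j | 0 < P t i j].

(* Edges of rounds k B + 1, ..., (k + 1) B. *)
Definition window_edge (P : nat -> 'M[R]_m) (B k : nat) : rel 'I_m :=
  [rel i j | [exists s : 'I_B, edge P (k * B + s.+1)%N i j]].

Definition network_assumption (P : nat -> 'M[R]_m) (zeta : R) (B : nat) :=
  [/\ forall t, (1 <= t)%N -> doubly_stochastic (P t),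
      0 < zeta
        /\ (forall t, (1 <= t)%N ->
             (forall i, zeta <= P t i i)
             /\ (forall i j, edge P t i j -> zeta <= P t i j))
    & (1 <= B)%N
        /\ (forall k i j, connect (window_edge P B k) i j)].

Definition diameter_assumption (N : 'rV[R]_d -> R) (K : set 'rV[R]_d) (DK : R) :=
  forall x y, K x -> K y -> N (x - y) <= DK.

(* dl i t is the (sub)gradient oracle of l i t.  Its bound is part of the
   assumption: Lipschitz continuity over K alone does not bound the
   subgradients at boundary points of K. *)
Definition loss_assumption (N : 'rV[R]_d -> R) (K : set 'rV[R]_d) (Gl : R)
    (l : 'I_m -> nat -> 'rV[R]_d -> R)
    (dl : 'I_m -> nat -> 'rV[R]_d -> 'rV[R]_d) (T : nat) :=
  forall i t, (1 <= t <= T)%N ->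
    [/\ convex_function setT (l i t),
        forall x, K x -> subgradient setT (l i t) x (dl i t x),
        lipschitz_over K N Gl (l i t)
      & forall x, K x -> dual_norm N (dl i t x) <= Gl].

(* Since w is only regular on K, its (sub)gradients are taken relative to K. *)
Definition mirror_map_assumption (N : 'rV[R]_d -> R) (K : set 'rV[R]_d)
    (w : 'rV[R]_d -> R) (dw : 'rV[R]_d -> 'rV[R]_d) (sw Gw : R) :=
  [/\ forall y, K y -> subgradient K w y (dw y),
      0 < sw,
      forall x y, K x -> K y ->
        w y + dotp (dw y) (x - y) + sw / 2 * N (x - y) ^+ 2 <= w x
    & forall x y, K x -> K y -> dual_norm N (dw x - dw y) <= Gw * N (x - y)].

Definition bregman_convexity_assumption (K : set 'rV[R]_d)
    (w : 'rV[R]_d -> R) (dw : 'rV[R]_d -> 'rV[R]_d) :=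
  forall (x : 'rV[R]_d) (n : nat) (a : 'I_n -> R) (y : 'I_n -> 'rV[R]_d),
    K x -> (forall i, K (y i)) ->
    (forall i, 0 <= a i) -> \sum_i a i = 1 ->
    bregman w dw x (\sum_i a i *: y i) <= \sum_i a i * bregman w dw x (y i).

End Assumptions.

Section Algorithm.
Variables (R : realType) (m d : nat).
Variables (K : set 'rV[R]_d) (r w : 'rV[R]_d -> R)
  (dw : 'rV[R]_d -> 'rV[R]_d).

(* g is the received (sub)gradient and x0 the current iterate. *)
Definition subproblem (eta : R) (g x0 x : 'rV[R]_d) : R :=
  dotp g x + r x + eta^-1 * bregman w dw x x0.

(* x i t are the iterates, ystar i t the exact and y i t the approximate
   solutions of the subproblems of node i at round t. *)
Definition ODCMD_run (P : nat -> 'M[R]_m)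
    (dl : 'I_m -> nat -> 'rV[R]_d -> 'rV[R]_d)
    (T : nat) (eta : R) (rho : nat -> R) (x y ystar : 'I_m -> nat -> 'rV[R]_d) :=
  (forall i, is_argmin K w (x i 1%N))
  /\ (forall i t, (1 <= t <= T)%N ->
      let F := subproblem eta (dl i t (x i t)) (x i t) in
      [/\ is_argmin K F (ystar i t),
          K (y i t),
          F (y i t) <= F (ystar i t) + rho t
        & x i t.+1 = \sum_j P t i j *: y j t]).

Definition cumulative_loss (l : 'I_m -> nat -> 'rV[R]_d -> R) (T : nat)
    (z : nat -> 'rV[R]_d) : R :=
  \sum_(1 <= t < T.+1) \sum_(j < m) (l j t (z t) + r (z t)).

Definition avg_regret (l : 'I_m -> nat -> 'rV[R]_d -> R) (T : nat)
    (x : 'I_m -> nat -> 'rV[R]_d) (xstar : 'rV[R]_d) (i : 'I_m) : R :=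
  T%:R^-1 * cumulative_loss l T (x i)
  - T%:R^-1 * cumulative_loss l T (fun=> xstar).

End Algorithm.

(* Main.v *)
Require Import Defs.
From HB Require Import structures.
From mathcomp Require Import all_boot all_order all_algebra.
From mathcomp Require Import zify ring lra.
From mathcomp Require Import all_classical all_reals all_analysis.
Import Order.TTheory GRing.Theory Num.Theory.
Import numFieldNormedType.Exports.
Local Open Scope classical_set_scope.
Local Open Scope ring_scope.

(** The regret of node j splits into the regret that the nodes would suffer if
    each loss l_i were evaluated at the iterate x_i of its own node, and the
    price of evaluating it at x_j instead, which the Lipschitz constants bound
    by the distances between the nodes.

    Own losses ([sum_own_loss_le]).  By first-order optimality
    ([subproblem_optimality]) an exact mirror step decreases the divergence
    V(x*, -) to the comparator x* by eta times the linearized regret, up to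
    a term of order eta ^+ 2 ([step_regret]).  The sum of these divergences over
    the nodes is a potential: it does not increase when the nodes average,
    because V is convex in its second argument and the weights are doubly
    stochastic ([sum_bregman_mix_le]).  So the decreases telescope, and
    eta = T^(-1/2) balances 1 / eta against T eta.  Solving a subproblem only up
    to rho_t displaces the solution by a distance of order sqrt(eta rho_t), the
    objective being strongly convex with modulus sw / eta
    ([subproblem_growth]).  The gradient of w being Lipschitz, the displacement
    changes the potential by a comparable amount.  With rho_t of order t^(-3/2)
    the displacements are of order T^(-1/4) t^(-3/4), and their sum over t <= T
    is bounded independently of T ([sum_inexactness_le]).

    Consensus ([sum_consensus_gap_le]).  Over a window of L = (m + 1) B rounds
    strong connectivity makes all entries of the product of the weight matrices
    at least zeta ^+ L ([transition_ge]).  Such a product shrinks the summed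
    distance of the nodes to their mean by the factor 1 - m zeta ^+ L
    ([disagreement_mix_le]), while the local steps in the window add at most
    twice their summed lengths ([disagreement_window]).  Summing this recursion
    over all rounds bounds the total disagreement by a constant plus
    a multiple of the total length of the local steps, which is of order
    T eta + 1 ([sum_contraction_le], [sum_local_step_le]).

    Both contributions are of order sqrt T, and the average over T rounds
    divides them by T. *)

Set Implicit Arguments.
Unset Strict Implicit.
Unset Printing Implicit Defensive.

(** * Norms and dual norms *)

Section NormTheory.
Variables (R : realType) (d : nat) (N : 'rV[R]_d -> R).
Hypothesis isN : is_norm N.
Implicit Types x y g : 'rV[R]_d.

Lemma norm_ge0 x : 0 <= N x. Proof. by case: isN. Qed.

Lemma norm_definite x : N x = 0 -> x = 0. Proof. by case: isN => _ + _ _; exact. Qed.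

Lemma norm_scale (a : R) x : N (a *: x) = `|a| * N x. Proof. by case: isN. Qed.

Lemma norm_add x y : N (x + y) <= N x + N y. Proof. by case: isN. Qed.

Lemma norm_zero : N 0 = 0.
Proof. by rewrite -(scale0r 0) norm_scale normr0 mul0r. Qed.

Lemma norm_opp x : N (- x) = N x.
Proof. by rewrite -scaleN1r norm_scale normrN1 mul1r. Qed.

Lemma norm_subC x y : N (x - y) = N (y - x).
Proof. by rewrite -opprB norm_opp. Qed.

Lemma norm_triangle y x z : N (x - z) <= N (x - y) + N (y - z).
Proof. by rewrite -[x - z](subrKA y) norm_add. Qed.

Lemma norm_sum (I : Type) (s : seq I) (F : I -> 'rV[R]_d) :
  N (\sum_(i <- s) F i) <= \sum_(i <- s) N (F i).
Proof.
elim: s => [|i s IH]; first by rewrite !big_nil norm_zero.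
by rewrite !big_cons (le_trans (norm_add _ _))// lerD2l.
Qed.

Lemma coord_le_sup_norm x k : `|x ord0 k| <= `|x|.
Proof.
rewrite [leRHS]/Num.norm /= mx_normrE; apply/bigmax_geP; right => /=.
by exists (ord0, k).
Qed.

Lemma norm_le_sup_norm : exists2 M, 0 <= M & forall x, N x <= M * `|x|.
Proof.
exists (\sum_k N (delta_mx ord0 k)); first by apply: sumr_ge0 => k _; exact: norm_ge0.
move=> x; rewrite {1}(row_sum_delta x) mulr_suml.
apply: le_trans (norm_sum _ _) _; apply: ler_sum => k _.
by rewrite norm_scale mulrC ler_wpM2l ?norm_ge0 ?coord_le_sup_norm.
Qed.

Lemma is_norm_continuous : continuous N.
Proof.
have [M M0 NM] := norm_le_sup_norm.
move=> x; apply/(@cvgrPdist_le R R^o _ (nbhs x)) => e e0.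
apply/(@nbhs_normP R 'rV[R]_d x); exists (e / (M + 1)) => [|z /= /ltW xz].
  by rewrite /= divr_gt0 ?ltr_wpDl.
have lip : `|N x - N z| <= M * `|x - z|.
  apply: le_trans (NM _); rewrite ler_norml; apply/andP; split.
    rewrite lerNl opprB lerBlDr norm_subC (le_trans _ (norm_add _ _))//.
    by rewrite subrK.
  by rewrite lerBlDr (le_trans _ (norm_add _ _))// subrK.
apply: (le_trans lip); apply: (@le_trans _ _ ((M + 1) * `|x - z|)).
  by rewrite ler_wpM2r// lerDl.
by rewrite mulrC -ler_pdivlMr ?ltr_wpDl.
Qed.

(** Norms on R^d are equivalent: N attains a positive minimum on the
    compact unit sphere of the supremum norm. *)
Lemma sup_norm_le_norm : exists2 c, 0 < c & forall x, c * `|x| <= N x.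
Proof.
pose S : set 'rV[R]_d := [set x | `|x| = 1].
have normalize x : x != 0 -> S (`|x|^-1 *: x).
  by move=> x0; rewrite /S /= normrZ normfV normr_id mulVf ?normr_eq0.
have [S0|nS] := pselect (S !=set0); last first.
  exists 1 => // x; have [->|x0] := eqVneq x 0.
    by rewrite normr0 mulr0 norm_zero.
  by case: nS; exists (`|x|^-1 *: x); exact: normalize.
have cS : compact S.
  apply: bounded_closed_compact.
    exists 1; split => [|a a1 x]; first exact: num_real.
    by rewrite /S /= => ->; exact: ltW.
  have -> : S = (fun x : 'rV[R]_d => `|x|) @^-1` [set 1] by [].
  apply: preimage_closed; last exact: closed_eq.
  by move=> x _; exact: norm_continuous.
have [c Sc cmin] := compact_EVT_min S0 cS (continuous_subspaceT is_norm_continuous).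
have c0 : 0 < N c.
  rewrite lt_def norm_ge0 andbT; apply/eqP => /norm_definite c0.
  by move: Sc; rewrite inE /S /= c0 normr0 => /eqP; rewrite eq_sym oner_eq0.
exists (N c) => // x; have [->|x0] := eqVneq x 0.
  by rewrite normr0 mulr0 norm_zero.
have := cmin _ (mem_set (normalize x x0)).
by rewrite norm_scale normfV normr_id ler_pdivlMl ?normr_gt0// mulrC.
Qed.

Lemma dotp_le_sup_norm x y : dotp x y <= d%:R * (`|x| * `|y|).
Proof.
have -> : d%:R * (`|x| * `|y|) = \sum_(k < d) `|x| * `|y|.
  by rewrite sumr_const card_ord mulr_natl.
apply: ler_sum => k _; apply: le_trans (ler_norm _) _; rewrite normrM.
by rewrite ler_pM ?coord_le_sup_norm.
Qed.

(** The supremum defining the dual norm is taken over a bounded set because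
    the unit sphere of N is bounded in the supremum norm. *)
Lemma dotp_le_dual_norm x y : dotp x y <= dual_norm N x * N y.
Proof.
have [y0|y0] := eqVneq (N y) 0.
  rewrite y0 mulr0 (norm_definite y0) /dotp big1// => k _.
  by rewrite mxE mulr0.
have Ny0 : 0 < N y by rewrite lt_def y0 norm_ge0.
have [c c0 cN] := sup_norm_le_norm.
rewrite -ler_pdivrMr//; apply: sup_ubound; last first.
  exists ((N y)^-1 *: y) => /=; first by rewrite norm_scale gtr0_norm ?invr_gt0// mulVf.
  rewrite /dotp mulr_suml; apply: eq_bigr => k _.
  by rewrite mxE mulrCA mulrC.
exists (d%:R * (`|x| * c^-1)) => _ [z /= z1 <-].
apply: le_trans (dotp_le_sup_norm _ _) _.
rewrite ler_wpM2l// ler_wpM2l// -[leRHS]mulr1 ler_pdivlMl// -z1.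
exact: cN.
Qed.
End NormTheory.

Section InnerProduct.
Variables (R : realType) (d : nat).
Implicit Types x y z : 'rV[R]_d.

Lemma dotpDl x y z : dotp (x + y) z = dotp x z + dotp y z.
Proof. by rewrite /dotp -big_split; apply: eq_bigr => k _; rewrite mxE mulrDl. Qed.

Lemma dotpZl (a : R) x z : dotp (a *: x) z = a * dotp x z.
Proof. by rewrite /dotp mulr_sumr; apply: eq_bigr => k _; rewrite mxE mulrA. Qed.

Lemma dotpC x y : dotp x y = dotp y x.
Proof. by apply: eq_bigr => k _; rewrite mulrC. Qed.

Lemma dotpDr x y z : dotp x (y + z) = dotp x y + dotp x z.
Proof. by rewrite dotpC dotpDl !(dotpC x). Qed.

Lemma dotpZr (a : R) x z : dotp x (a *: z) = a * dotp x z.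
Proof. by rewrite dotpC dotpZl (dotpC x). Qed.

Lemma dotpNl x z : dotp (- x) z = - dotp x z.
Proof. by rewrite -scaleN1r dotpZl mulN1r. Qed.

Lemma dotpNr x z : dotp x (- z) = - dotp x z.
Proof. by rewrite dotpC dotpNl dotpC. Qed.

Definition dotpE := (dotpDl, dotpDr, dotpNl, dotpNr, dotpZl, dotpZr).
End InnerProduct.

(** * Convex combinations *)

Section ConvexSets.
Variables (R : realType) (d : nat).
Implicit Types x y z : 'rV[R]_d.

Lemma convex_set_segment (K : set 'rV[R]_d) (t : R) x y :
  convex_set K -> 0 <= t <= 1 -> K x -> K y -> K (t *: x + (1 - t) *: y).
Proof.
move=> cK /andP[t0 t1] Kx Ky.
exact/set_mem/(cK x y (Itv01 t0 t1) (mem_set Kx) (mem_set Ky)).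
Qed.

Lemma convex_function_segment (f : 'rV[R]_d -> R) (t : R) x y :
  convex_function setT f -> 0 <= t <= 1 ->
  f (t *: x + (1 - t) *: y) <= t * f x + (1 - t) * f y.
Proof.
move=> cf /andP[t0 t1].
exact: (cf (Itv01 t0 t1) x y (mem_set I) (mem_set I)).
Qed.

Lemma convex_set_sum (K : set 'rV[R]_d) (I : Type) (s : seq I)
    (a : I -> R) (y : I -> 'rV[R]_d) :
  convex_set K -> (forall i, K (y i)) -> (forall i, 0 <= a i) ->
  \sum_(i <- s) a i = 1 -> K (\sum_(i <- s) a i *: y i).
Proof.
move=> cK Ky a0 a1.
(* Partial sums are renormalized by their total weight. *)
suff H : 0 < \sum_(i <- s) a i ->
    K ((\sum_(i <- s) a i)^-1 *: \sum_(i <- s) a i *: y i).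
  by move: H; rewrite a1 invr1 scale1r; apply; exact: ltr01.
have null s' : \sum_(j <- s') a j = 0 -> \sum_(j <- s') a j *: y j = 0.
  elim: s' => [|j s' IHs]; first by rewrite !big_nil.
  rewrite !big_cons => /eqP; rewrite paddr_eq0 ?sumr_ge0// => /andP[/eqP -> /eqP s0].
  by rewrite scale0r add0r IHs.
elim: s {a1} => [|i s IH]; first by rewrite big_nil ltxx.
rewrite !big_cons; set A := \sum_(j <- s) a j; set Y := \sum_(j <- s) _ *: _.
have A0 : 0 <= A by apply: sumr_ge0.
move=> aA0; have [Az|Anz] := eqVneq A 0.
  have -> : Y = 0 by exact: null.
  rewrite Az !addr0 in aA0 *.
  by rewrite scalerA mulVf ?gt_eqF// scale1r.
have {}A0 : 0 < A by rewrite lt_def Anz.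
have := @convex_set_segment K (a i / (a i + A)) _ _ cK _ (Ky i) (IH A0).
rewrite scalerDr !scalerA.
have -> : (1 - a i / (a i + A)) * A^-1 = (a i + A)^-1.
  by field; rewrite Anz gt_eqF.
rewrite [a i / _]mulrC; apply.
by rewrite mulr_ge0 ?invr_ge0 ?(ltW aA0)//= mulrC ler_pdivrMr// mul1r lerDl ltW.
Qed.
End ConvexSets.

(** * Inexact mirror steps *)

Lemma le0_of_le_small (R : realFieldType) (A B : R) :
  (forall t, 0 < t <= 1 -> A <= t * B) -> A <= 0.
Proof.
move=> H; rewrite leNgt; apply/negP => A0.
have AB0 : 0 < A + `|B| by rewrite ltr_wpDr.
have := H (A / (A + `|B|)); rewrite divr_gt0//= ler_pdivrMr// mul1r lerDl normr_ge0.
move=> /(_ isT); rewrite mulrAC ler_pdivlMr// ler_pM2l//.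
by have := ler_norm B; lra.
Qed.

Section MirrorStep.
Variables (R : realType) (d : nat) (N : 'rV[R]_d -> R) (K : set 'rV[R]_d).
Variables (r w : 'rV[R]_d -> R) (dw : 'rV[R]_d -> 'rV[R]_d) (sw Gw : R).
Hypotheses (isN : is_norm N) (cK : convex_set K) (cr : convex_function setT r).
Hypothesis mirror : mirror_map_assumption N K w dw sw Gw.
Implicit Types x y z g : 'rV[R]_d.

Let sw_gt0 : 0 < sw. Proof. by case: mirror. Qed.

Lemma bregman_ge x y : K x -> K y -> sw / 2 * N (x - y) ^+ 2 <= bregman w dw x y.
Proof.
move=> Kx Ky; case: mirror => _ _ /(_ x y Kx Ky) + _.
by rewrite /bregman; lra.
Qed.

Lemma dotp_mirror_le x y z : K x -> K y ->
  dotp (dw x - dw y) z <= Gw * N (x - y) * N z.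
Proof.
move=> Kx Ky; apply: le_trans (dotp_le_dual_norm isN _ _) _.
by rewrite ler_wpM2r ?norm_ge0//; case: mirror => _ _ _; exact.
Qed.

Lemma bregman_le x y : K x -> K y -> bregman w dw x y <= Gw * N (x - y) ^+ 2.
Proof.
move=> Kx Ky; have := dotp_mirror_le (x - y) Kx Ky.
case: mirror => /(_ x Kx y Ky) + _ _ _.
by rewrite /bregman !dotpE expr2 mulrA; lra.
Qed.

(** The three-point identity of Bregman divergences. *)
Lemma bregman_three_points x y z :
  dotp (dw y - dw x) (z - y) =
  bregman w dw z x - bregman w dw z y - bregman w dw y x.
Proof. by rewrite /bregman !dotpE; ring. Qed.

Lemma mirror_map_midpoint x y : K x -> K y ->
  w (2^-1 *: x + (1 - 2^-1) *: y) <= (w x + w y) / 2 - sw / 8 * N (x - y) ^+ 2.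
Proof.
move=> Kx Ky; set h := _ + _.
have half : 0 <= (2^-1 : R) <= 1 by lra.
have Kh : K h by exact: convex_set_segment.
have [_ _ sc _] := mirror.
have xh : x - h = 2^-1 *: (x - y).
  by apply/rowP => k; rewrite /h !mxE; field.
have yh : y - h = - (2^-1 *: (x - y)).
  by apply/rowP => k; rewrite /h !mxE; field.
have := sc _ _ Kx Kh; have := sc _ _ Ky Kh.
rewrite xh yh (norm_opp isN) (norm_scale isN) dotpNr dotpZr gtr0_norm// exprMn.
by move=> H1 H2; lra.
Qed.

Section Subproblem.
Variables (eta : R) (g x0 ys : 'rV[R]_d).
Hypothesis eta_gt0 : 0 < eta.
Let F := subproblem r w dw eta g x0.
Hypothesis ys_min : is_argmin K F ys.

(** The midpoint h of y and ys satisfies F ys <= F h, whereas F h lies below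
    (F y + F ys) / 2 by a multiple of the squared distance, F inheriting the
    strong convexity of w. *)
Lemma subproblem_growth y : K y -> sw / (4 * eta) * N (y - ys) ^+ 2 <= F y - F ys.
Proof.
case: ys_min => Ks ms Ky.
have half : 0 <= (2^-1 : R) <= 1 by lra.
have := ms _ (convex_set_segment cK half Ky Ks).
have := mirror_map_midpoint Ky Ks.
have := convex_function_segment y ys cr half.
rewrite /F /subproblem /bregman.
set h := _ + _ => Hr Hw.
have -> : dotp g h = (dotp g y + dotp g ys) / 2 by rewrite /h !dotpE; field.
have -> : dotp (dw x0) (h - x0) =
    (dotp (dw x0) (y - x0) + dotp (dw x0) (ys - x0)) / 2.
  by rewrite /h !dotpE; field.
have : eta^-1 * w h <= eta^-1 * ((w y + w ys) / 2 - sw / 8 * N (y - ys) ^+ 2).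
  by rewrite ler_wpM2l// invr_ge0 ltW.
have -> : sw / (4 * eta) = eta^-1 * sw / 4 by field; rewrite gt_eqF.
by move=> Hw'; lra.
Qed.

(** First-order optimality.  Moving from the minimizer a fraction t towards z
    changes w by t times its directional derivative up to an error of order
    t ^+ 2, because the gradient of w is Lipschitz; then t tends to 0. *)
Lemma subproblem_optimality z : K z ->
  dotp g (ys - z) + r ys - r z <= eta^-1 * dotp (dw ys - dw x0) (z - ys).
Proof.
case: ys_min => Ks ms Kz; rewrite -subr_le0.
apply: (@le0_of_le_small _ _ (eta^-1 * (Gw * N (z - ys) ^+ 2))) => t /andP[t0 t1].
have t01 : 0 <= t <= 1 by rewrite ltW.
have Kh := convex_set_segment cK t01 Kz Ks.
have := ms _ Kh; have := convex_function_segment z ys cr t01.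
move: Kh; set h := _ + _ => Kh.
have hs : h - ys = t *: (z - ys).
  by apply/rowP => k; rewrite /h !mxE; ring.
have := bregman_le Kh Ks.
have hx : h - x0 = t *: (z - ys) + (ys - x0) by rewrite -hs subrKA.
rewrite /F /subproblem /bregman hx hs (norm_scale isN) gtr0_norm// exprMn.
have -> : h = t *: (z - ys) + ys by rewrite -hs subrK.
rewrite !dotpE => Hw Hr HF.
have {}Hw : eta^-1 * (w (t *: (z - ys) + ys) - w ys
      - t * (dotp (dw ys) z - dotp (dw ys) ys)) <=
    eta^-1 * (Gw * (t ^+ 2 * N (z - ys) ^+ 2)).
  by rewrite ler_wpM2l ?invr_ge0 ?(ltW eta_gt0)//; lra.
rewrite -(ler_pM2l t0); move: Hr; rewrite -/h; move: HF Hw; lra.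
Qed.

Variables (Gl Gr DK : R).
Hypotheses (Gl_ge0 : 0 <= Gl) (Gr_ge0 : 0 <= Gr) (Gw_ge0 : 0 <= Gw).
Hypotheses (Kx0 : K x0) (g_le : dual_norm N g <= Gl).
Hypotheses (r_lip : lipschitz_over K N Gr r) (K_diam : diameter_assumption N K DK).

Let Ks : K ys. Proof. by case: ys_min. Qed.

Lemma linearized_loss_le x y : K x -> K y ->
  dotp g (x - y) + r x - r y <= (Gl + Gr) * N (x - y).
Proof.
move=> Kx Ky; rewrite mulrDl -addrA lerD//.
  by rewrite (le_trans (dotp_le_dual_norm isN _ _))// ler_wpM2r ?norm_ge0.
exact: le_trans (ler_norm _) (r_lip Kx Ky).
Qed.

(** By optimality of ys against x0 the linearized loss decreases by at least
    sw / eta times the squared length of the step, whereas the Lipschitz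
    constants allow a decrease of at most Gl + Gr times that length. *)
Lemma exact_step_le : N (ys - x0) <= eta * (Gl + Gr) / sw.
Proof.
have := subproblem_optimality Kx0; rewrite bregman_three_points.
have -> : bregman w dw x0 x0 = 0 by rewrite /bregman !dotpE; ring.
have := linearized_loss_le Kx0 Ks; rewrite !dotpE (norm_subC isN x0).
have := bregman_ge Kx0 Ks; have := bregman_ge Ks Kx0; rewrite (norm_subC isN x0).
set n := N _; move=> V1 V2 L opt.
have n0 : 0 <= n by exact: norm_ge0.
have {}V : eta^-1 * (sw * n ^+ 2) <= eta^-1 * (bregman w dw x0 ys + bregman w dw ys x0).
  by rewrite ler_wpM2l ?invr_ge0 ?(ltW eta_gt0)//; lra.
have {V opt L}: eta^-1 * (sw * n ^+ 2) <= (Gl + Gr) * n by lra.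
rewrite ler_pdivrMl// => H.
have [->|nz] := eqVneq n 0.
  by rewrite divr_ge0 ?mulr_ge0 ?addr_ge0 ?(ltW eta_gt0) ?(ltW sw_gt0).
have {}n0 : 0 < n by rewrite lt_def nz.
by rewrite ler_pdivlMr// -(ler_pM2r n0); move: H; rewrite expr2; lra.
Qed.

Lemma bregman_shift_le y z : K y -> K z ->
  bregman w dw z y <= bregman w dw z ys + 2 * Gw * DK * N (y - ys).
Proof.
move=> Ky Kz.
have := bregman_three_points y ys z.
have H1 := dotp_mirror_le (z - ys) Ks Ky.
have H2 := bregman_le Ks Ky.
have n0 : 0 <= N (y - ys) by exact: norm_ge0.
have H3 : Gw * N (ys - y) * N (z - ys) <= Gw * N (ys - y) * DK.
  by rewrite ler_wpM2l ?K_diam// mulr_ge0 ?norm_ge0.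
have H4 : Gw * N (ys - y) * N (ys - y) <= Gw * N (ys - y) * DK.
  by rewrite ler_wpM2l ?K_diam// mulr_ge0 ?norm_ge0.
move: H1 H2 H3 H4; rewrite expr2 (norm_subC isN ys y).
by lra.
Qed.

(** The step from x0 to ys costs at most (Gl + Gr) n with n the norm of the
    step, and optimality gains back sw n ^+ 2 / (2 eta); the difference is
    maximal at n = eta (Gl + Gr) / sw. *)
Lemma step_regret y z : K y -> K z ->
  dotp g (x0 - z) + r x0 - r z <=
  eta^-1 * (bregman w dw z x0 - bregman w dw z y)
  + eta * (Gl + Gr) ^+ 2 / (2 * sw) + 2 * Gw * DK / eta * N (y - ys).
Proof.
move=> Ky Kz.
have := subproblem_optimality Kz; rewrite bregman_three_points => opt.
have L := linearized_loss_le Kx0 Ks.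
have V := bregman_ge Ks Kx0.
have shift := bregman_shift_le Ky Kz.
move: opt L; rewrite !dotpE (norm_subC isN x0) => opt L.
set n := N (ys - x0) in L V.
have ie0 : 0 <= eta^-1 by rewrite invr_ge0 ltW.
have {}V := ler_wpM2l ie0 V; have {}shift := ler_wpM2l ie0 shift.
have : 0 <= (eta * (Gl + Gr) - sw * n) ^+ 2 / (2 * eta * sw).
  by rewrite divr_ge0 ?sqr_ge0// !mulr_ge0 ?(ltW eta_gt0) ?(ltW sw_gt0).
have -> : (eta * (Gl + Gr) - sw * n) ^+ 2 / (2 * eta * sw) =
   eta * (Gl + Gr) ^+ 2 / (2 * sw) - (Gl + Gr) * n + eta^-1 * (sw / 2 * n ^+ 2).
  by field; rewrite !gt_eqF.
have -> : 2 * Gw * DK / eta * N (y - ys) = eta^-1 * (2 * Gw * DK * N (y - ys)).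
  by field; rewrite gt_eqF.
by lra.
Qed.

End Subproblem.
End MirrorStep.

(** * Averaging over the network *)

Section DoublyStochastic.
Variables (R : realType) (m : nat).
Implicit Types A : 'M[R]_m.

Lemma doubly_stochastic1 : doubly_stochastic (1%:M : 'M[R]_m).
Proof.
split=> [i j|i|j]; first by rewrite mxE ler0n.
  rewrite (bigD1 i)//= big1 => [|j /negPf ij]; first by rewrite mxE eqxx addr0.
  by rewrite mxE eq_sym ij.
rewrite (bigD1 j)//= big1 => [|i /negPf ij]; first by rewrite mxE eqxx addr0.
by rewrite mxE ij.
Qed.

Lemma doubly_stochastic_mulmx A A' :
  doubly_stochastic A -> doubly_stochastic A' -> doubly_stochastic (A *m A').
Proof.
move=> [A0 Ar Ac] [A'0 A'r A'c]; split=> [i j|i|j].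
- by rewrite mxE sumr_ge0// => k _; rewrite mulr_ge0.
- under eq_bigr do rewrite mxE.
  rewrite exchange_big/= -(Ar i); apply: eq_bigr => k _.
  by rewrite -mulr_sumr A'r mulr1.
- under eq_bigr do rewrite mxE.
  rewrite exchange_big/= -(A'c j); apply: eq_bigr => k _.
  by rewrite -mulr_suml Ac mul1r.
Qed.

Variables (d : nat) (N : 'rV[R]_d -> R).
Hypothesis isN : is_norm N.
Implicit Types u v z : 'I_m -> 'rV[R]_d.

Definition mean v : 'rV[R]_d := m%:R^-1 *: \sum_i v i.

Definition disagreement v : R := \sum_i N (v i - mean v).

Definition mix A v : 'I_m -> 'rV[R]_d := fun i => \sum_j A i j *: v j.

Lemma sum_mix A v : doubly_stochastic A -> \sum_i mix A v i = \sum_i v i.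
Proof.
move=> [_ _ Ac]; rewrite /mix exchange_big/=; apply: eq_bigr => j _.
by rewrite -scaler_suml Ac scale1r.
Qed.

Lemma sum_norm_mix_le A v : doubly_stochastic A ->
  \sum_i N (mix A v i) <= \sum_i N (v i).
Proof.
move=> [A0 _ Ac].
apply: (@le_trans _ _ (\sum_i \sum_j A i j * N (v j))).
  apply: ler_sum => i _; apply: le_trans (norm_sum isN _ _) _.
  by apply: ler_sum => j _; rewrite (norm_scale isN) ger0_norm.
rewrite exchange_big/=; apply: ler_sum => j _.
by rewrite -mulr_suml Ac mul1r.
Qed.

Lemma disagreement_ge0 v : 0 <= disagreement v.
Proof. by apply: sumr_ge0 => i _; exact: norm_ge0. Qed.

Hypothesis m_gt0 : (0 < m)%N.
Let m_neq0 : m%:R != 0 :> R. Proof. by rewrite pnatr_eq0 -lt0n. Qed.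

Lemma sum_sub_mean v : \sum_i (v i - mean v) = 0.
Proof.
rewrite sumrB sumr_const card_ord /mean -scaler_nat scalerA divff// scale1r.
by rewrite subrr.
Qed.

(** The deviations from the mean sum to 0, so that delta can be subtracted
    from all entries of A without changing their average under A; the columns
    of what remains sum to 1 - m delta. *)
Lemma disagreement_mix_le A (delta : R) v : doubly_stochastic A ->
  (forall i j, delta <= A i j) ->
  disagreement (mix A v) <= (1 - m%:R * delta) * disagreement v.
Proof.
move=> dsA deltaA; have [_ Ar Ac] := dsA.
have E i : mix A v i - mean (mix A v) =
    \sum_j (A i j - delta) *: (v j - mean v).
  rewrite {1}/mean sum_mix// -/(mean v).
  under eq_bigr do rewrite scalerBl.
  rewrite sumrB -[in X in _ = _ - X]scaler_sumr sum_sub_mean scaler0 subr0.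
  under eq_bigr do rewrite scalerBr.
  by rewrite sumrB -scaler_suml Ar scale1r.
apply: (@le_trans _ _ (\sum_i \sum_j (A i j - delta) * N (v j - mean v))).
  apply: ler_sum => i _; rewrite E; apply: le_trans (norm_sum isN _ _) _.
  by apply: ler_sum => j _; rewrite (norm_scale isN) ger0_norm ?subr_ge0.
rewrite exchange_big/= /disagreement mulr_sumr; apply: ler_sum => j _.
by rewrite -mulr_suml sumrB Ac sumr_const card_ord mulr_natl.
Qed.

Lemma disagreement_perturb u v :
  disagreement u <= disagreement v + 2 * \sum_i N (u i - v i).
Proof.
have mean_le : m%:R * N (mean v - mean u) <= \sum_i N (u i - v i).
  rewrite /mean -scalerBr (norm_scale isN) normfV normr_nat mulVKf//.
  by rewrite (norm_subC isN) -sumrB (norm_sum isN).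
have -> : 2 * \sum_i N (u i - v i) =
  \sum_i N (u i - v i) + \sum_i N (u i - v i) by rewrite mulr_natl.
rewrite addrA; apply: le_trans (lerD (lexx _) mean_le).
have -> : m%:R * N (mean v - mean u) = \sum_(i < m) N (mean v - mean u).
  by rewrite sumr_const card_ord mulr_natl.
rewrite /disagreement -!big_split/=; apply: ler_sum => i _.
apply: le_trans (norm_triangle isN (mean v) _ _) _; rewrite lerD2r.
by rewrite addrC; exact: norm_triangle.
Qed.

Lemma sum_dist_le v j :
  \sum_i N (v j - v i) <= (m%:R + 1) * disagreement v.
Proof.
rewrite mulrDl mul1r.
have jle : N (v j - mean v) <= disagreement v.
  rewrite /disagreement (bigD1 j)//= lerDl sumr_ge0// => i _; exact: norm_ge0.
apply: (@le_trans _ _ (m%:R * N (v j - mean v) + disagreement v)); last first.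
  by rewrite lerD2r ler_wpM2l.
have -> : m%:R * N (v j - mean v) = \sum_(i < m) N (v j - mean v).
  by rewrite sumr_const card_ord mulr_natl.
rewrite /disagreement -big_split/=; apply: ler_sum => i _.
by rewrite (norm_subC isN (v i)); exact: norm_triangle.
Qed.

Lemma disagreement_le_diameter K (D : R) v :
  convex_set K -> diameter_assumption N K D ->
  (forall i, K (v i)) -> disagreement v <= m%:R * D.
Proof.
move=> cK KD Kv.
have -> : m%:R * D = \sum_(i < m) D by rewrite sumr_const card_ord mulr_natl.
apply: ler_sum => i _; apply: KD => //.
rewrite /mean scaler_sumr; apply: convex_set_sum => //.
by rewrite sumr_const card_ord -[LHS]mulr_natl divff.
Qed.
End DoublyStochastic.

Section Network.
Variables (R : realType) (m : nat) (P : nat -> 'M[R]_m) (zeta : R) (B : nat).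
Hypothesis network : network_assumption P zeta B.

Let zeta_gt0 : 0 < zeta. Proof. by case: network => _ []. Qed.
Let zeta_ge0 : 0 <= zeta. Proof. exact: ltW. Qed.

Fixpoint transition (s n : nat) : 'M[R]_m :=
  if n is n'.+1 then P (s + n')%N *m transition s n' else 1%:M.

Lemma transition_doubly_stochastic s n :
  (0 < s)%N -> doubly_stochastic (transition s n).
Proof.
move=> s0; elim: n => [|n IH] /=; first exact: doubly_stochastic1.
apply: doubly_stochastic_mulmx => //.
by case: network => ds _ _; apply: ds; rewrite addn_gt0 s0.
Qed.

(** The threshold zeta ^+ n is what the weights along a walk of n edges or
    self-loops multiply to at least, so that every node reached from j within
    n rounds belongs to the set. *)
Definition influenced (s : nat) (j : 'I_m) (n : nat) : {set 'I_m} :=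
  [set i | zeta ^+ n <= transition s n i j]%SET.

Lemma influenced_edge s j n i k : (0 < s)%N ->
  0 < P (s + n)%N i k -> k \in influenced s j n -> i \in influenced s j n.+1.
Proof.
move=> s0 ik; rewrite !inE /= mxE (bigD1 k)//= exprS => jk.
have sn0 : (0 < s + n)%N by rewrite addn_gt0 s0.
have [ds [_ lower] _] := network.
have [P0 _ _] := ds _ sn0.
have [T0 _ _] := transition_doubly_stochastic n s0.
rewrite -[leLHS]addr0 lerD ?sumr_ge0//; last by move=> h _; rewrite mulr_ge0.
by rewrite ler_pM ?exprn_ge0//; have [_] := lower _ sn0; apply.
Qed.

Lemma influenced_mono s j n n' : (0 < s)%N -> (n <= n')%N ->
  influenced s j n \subset influenced s j n'.
Proof.
move=> s0 /subnK <-; elim: (n' - n)%N => [//|c IH]; rewrite addSn.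
apply: (fintype.subset_trans IH); apply/fintype.subsetP => i.
apply: influenced_edge => //.
have [_ [_ lower] _] := network.
have [|+ _] := lower (s + (c + n))%N; first by rewrite addn_gt0 s0.
by move=> /(_ i); exact: lt_le_trans.
Qed.

(** If no node joined the influenced set during a window, then no edge of that
    window would enter the set from outside, against strong connectivity. *)
Lemma influenced_grows s j n k : (0 < s)%N -> (s + n = (k * B).+1)%N ->
  influenced s j n != [set: 'I_m]%SET ->
  (#|influenced s j n| < #|influenced s j (n + B)|)%N.
Proof.
move=> s0 snk notT; set S := influenced s j n.
have SB : S \subset influenced s j (n + B) by rewrite influenced_mono ?leq_addr.
have [_ _ [_ conn]] := network.
apply: proper_card; rewrite properE SB /=; apply/negP => BS.
have closed i h : window_edge P B k i h -> h \in S -> i \in S.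
  move=> /existsP[c ehc] hS; apply: (fintype.subsetP BS).
  apply: (fintype.subsetP (influenced_mono j s0 (_ : (n + c).+1 <= _)%N)).
    by rewrite ltn_add2l.
  apply: (influenced_edge (k := h)) => //.
    by rewrite addnA snk addSnnS.
  by apply: (fintype.subsetP (influenced_mono j s0 _)) hS; exact: leq_addr.
have jS : j \in S.
  apply: (fintype.subsetP (influenced_mono j s0 (leq0n n))).
  by rewrite inE /= mxE eqxx.
case/negP: notT; apply/eqP/setP => i; rewrite finset.in_setT; apply/idP.
have /connectP[p ep jp] := conn k i j.
elim: p i ep jp => [i _ /= <- //|h p IH i /= /andP[ih hp] jp].
exact: closed ih (IH _ hp jp).
Qed.

Lemma influenced_full s j : (0 < s)%N ->
  influenced s j (m.+1 * B) = [set: 'I_m]%SET.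
Proof.
move=> s0; have [_ _ [B0 _]] := network.
(* The first window that starts after round s starts in round s + n0. *)
pose n0 := (B - s.-1 %% B)%N.
have start c : (s + (n0 + c * B) = ((s.-1 %/ B).+1 + c) * B + 1)%N.
  have := divn_eq s.-1 B; have := ltn_pmod s.-1 B0; rewrite /n0.
  rewrite !mulnDl mulSn; lia.
have grow c : (c < #|influenced s j (n0 + c * B)|)%N
    || (influenced s j (n0 + c * B) == [set: 'I_m]%SET).
  elim: c => [|c IH].
    apply/orP; left; apply/card_gt0P; exists j.
    apply: (fintype.subsetP (influenced_mono j s0 (leq0n _))).
    by rewrite inE /= mxE eqxx.
  have [full|notfull] := eqVneq (influenced s j (n0 + c * B)) [set: 'I_m]%SET.
    apply/orP; right; rewrite finset.eqEsubset finset.subsetT -full influenced_mono//.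
    by rewrite leq_add2l leq_mul2r leqnSn orbT.
  rewrite (negPf notfull) orbF in IH.
  have := influenced_grows s0 _ notfull; rewrite -addnA -mulSnr.
  move=> /(_ ((s.-1 %/ B).+1 + c)%N); rewrite start addn1 => /(_ erefl) H.
  by rewrite (leq_ltn_trans IH H).
have /orP[|/eqP full] := grow m.
  by rewrite ltnNge (leq_trans (max_card _)) ?card_ord.
apply/eqP; rewrite finset.eqEsubset finset.subsetT -full influenced_mono//.
by rewrite mulSn leq_add2r leq_subr.
Qed.

Lemma transition_ge s i j : (0 < s)%N ->
  zeta ^+ (m.+1 * B) <= transition s (m.+1 * B) i j.
Proof.
move=> s0; have := finset.in_setT i.
by rewrite -(influenced_full j s0) inE.
Qed.

Variables (d : nat) (N : 'rV[R]_d -> R) (x y : 'I_m -> nat -> 'rV[R]_d).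
Hypothesis isN : is_norm N.

(** The iterates follow the unperturbed averaging dynamics up to the sum of the
    local steps, since averaging does not increase the sum of the norms. *)
Lemma transition_perturb s n : (0 < s)%N ->
  (forall t i, (s <= t < s + n)%N -> x i t.+1 = mix (P t) (y^~ t) i) ->
  \sum_i N (x i (s + n)%N - mix (transition s n) (x^~ s) i) <=
  \sum_(c < n) \sum_i N (y i (s + c)%N - x i (s + c)%N).
Proof.
move=> s0; elim: n => [|n IH] rec.
  rewrite big_ord0 big1// => i _; rewrite addn0 /mix /= (bigD1 i)//= big1.
    by rewrite mxE eqxx scale1r addr0 subrr norm_zero.
  by move=> j /negPf ij; rewrite mxE eq_sym ij scale0r.
rewrite big_ord_recr /= addnS.
have dsP : doubly_stochastic (P (s + n)%N).
  by case: network => ds _ _; apply: ds; rewrite addn_gt0 s0.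
pose z := mix (transition s n) (x^~ s).
have step i : x i (s + n).+1 - mix (P (s + n)%N *m transition s n) (x^~ s) i =
    mix (P (s + n)%N) (fun k => y k (s + n)%N - z k) i.
  rewrite rec ?leq_addr ?addnS ?ltnSn// /mix.
  under [in RHS]eq_bigr do rewrite scalerBr.
  rewrite sumrB; congr (_ - _).
  under eq_bigr do rewrite mxE scaler_suml.
  rewrite exchange_big/=; apply: eq_bigr => k _.
  by rewrite /z /mix scaler_sumr; apply: eq_bigr => h _; rewrite scalerA.
under eq_bigr do rewrite step.
apply: le_trans (sum_norm_mix_le isN _ dsP) _.
apply: le_trans (lerD (IH _) (lexx _)); last first.
  by move=> t i /andP[st tn]; apply: rec; rewrite st addnS ltnW.
rewrite -big_split/=; apply: ler_sum => i _.
by rewrite addrC; exact: norm_triangle.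
Qed.

Lemma disagreement_window s : (0 < m)%N -> (0 < s)%N ->
  let L := (m.+1 * B)%N in
  (forall t i, (s <= t < s + L)%N -> x i t.+1 = mix (P t) (y^~ t) i) ->
  disagreement N (x^~ (s + L)%N) <=
  (1 - m%:R * zeta ^+ L) * disagreement N (x^~ s)
  + 2 * \sum_(c < L) \sum_i N (y i (s + c)%N - x i (s + c)%N).
Proof.
move=> m0 s0 L rec.
have ds := transition_doubly_stochastic L s0.
apply: le_trans (disagreement_perturb isN m0 _ (mix (transition s L) (x^~ s))) _.
apply: lerD.
  by apply: disagreement_mix_le => // i j; exact: transition_ge.
by rewrite ler_wpM2l// transition_perturb.
Qed.
End Network.

(** * Sums of scalar sequences *)

Section ScalarSums.
Variable R : realType.
Implicit Types f v e : nat -> R.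

Lemma ler_sum_subrange f a b a' b' : (forall t, 0 <= f t) ->
  (a' <= a)%N -> (b <= b')%N ->
  \sum_(a <= t < b) f t <= \sum_(a' <= t < b') f t.
Proof.
move=> f0 aa bb; have [ba|ab] := leqP b a; first by rewrite big_geq ?sumr_ge0.
rewrite [leRHS](big_cat_nat aa)/=; last exact: leq_trans (ltnW ab) bb.
rewrite [in leRHS](big_cat_nat (ltnW ab) bb)/=.
by rewrite addrCA lerDl addr_ge0 ?sumr_ge0.
Qed.

(** Summing the recursion over all s bounds the sum of v by its first L terms,
    plus 1 - delta times itself, plus twice the terms e t, each of which enters
    at most L times. *)
Lemma sum_contraction_le (T L : nat) (delta D : R) v e :
  (forall t, 0 <= v t) -> (forall t, 0 <= e t) -> 0 <= D -> delta <= 1 ->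
  (forall t, (0 < t <= T)%N -> v t <= D) ->
  (forall s, (0 < s)%N -> (s + L <= T)%N ->
     v (s + L)%N <= (1 - delta) * v s + 2 * \sum_(c < L) e (s + c)%N) ->
  delta * \sum_(1 <= t < T.+1) v t <=
  L%:R * D + 2 * L%:R * \sum_(1 <= t < T.+1) e t.
Proof.
move=> v0 e0 D0 d1 vD rec.
set V := \sum_(1 <= t < T.+1) v t; set E := \sum_(1 <= t < T.+1) e t.
have head t1 : (t1 <= L)%N -> (t1 <= T)%N -> \sum_(1 <= t < t1.+1) v t <= L%:R * D.
  move=> tL tT; apply: (@le_trans _ _ (\sum_(1 <= t < t1.+1) D)).
    by apply: ler_sum_nat => t /andP[t0 tt]; rewrite vD// t0 (leq_trans _ tT).
  by rewrite sumr_const_nat subn1 /= -[leLHS]mulr_natl ler_wpM2r// ler_nat.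
have split : V <= L%:R * D + \sum_(1 <= s < (T - L).+1) v (s + L)%N.
  have [TL|LT] := leqP T L.
    by rewrite (eqP TL) big_geq// addr0 head.
  rewrite /V (@big_cat_nat _ _ _ L.+1)//=; last by rewrite ltnS ltnW.
  rewrite lerD ?head ?(ltnW LT)//.
  by rewrite -[L.+1]add1n big_addn subSn// ltnW.
have tail : \sum_(1 <= s < (T - L).+1) v (s + L)%N <=
    (1 - delta) * V + 2 * (L%:R * E).
  apply: (@le_trans _ _ (\sum_(1 <= s < (T - L).+1)
      ((1 - delta) * v s + 2 * \sum_(c < L) e (s + c)%N))).
    by apply: ler_sum_nat => s /andP[s0 sT]; apply: rec => //; lia.
  rewrite big_split/= -!mulr_sumr lerD//.
    by rewrite ler_wpM2l ?subr_ge0// ler_sum_subrange// ltnS leq_subr.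
  rewrite ler_wpM2l// exchange_big/=.
  have -> : L%:R * E = \sum_(c < L) E by rewrite sumr_const card_ord mulr_natl.
  apply: ler_sum => c _.
  have -> : \sum_(1 <= s < (T - L).+1) e (s + c)%N =
      \sum_(1 + c <= t < (T - L).+1 + c) e t.
    by rewrite big_addn addnK.
  by have [LT|TL] := leqP L T; [apply: ler_sum_subrange => //; have := ltn_ord c; lia
    | rewrite big_geq ?sumr_ge0//; lia].
by move: split tail; lra.
Qed.

Definition root4 (t : nat) : R := Num.sqrt (Num.sqrt t%:R).

Lemma root4_ge0 t : 0 <= root4 t. Proof. exact: sqrtr_ge0. Qed.

Lemma root4_gt0 t : (0 < t)%N -> 0 < root4 t.
Proof. by move=> t0; rewrite !sqrtr_gt0 ltr0n. Qed.

Lemma root4_sqr t : root4 t ^+ 2 = Num.sqrt t%:R.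
Proof. by rewrite sqr_sqrtr ?sqrtr_ge0. Qed.

Lemma root4_pow4 t : root4 t ^+ 4 = t%:R.
Proof. by rewrite (exprM _ 2 2) root4_sqr sqr_sqrtr. Qed.

(** With a and b the fourth roots of t + 1 and t,
    1 = a ^+ 4 - b ^+ 4 <= 4 a ^+ 3 (a - b), and the differences telescope. *)
Lemma sum_root4_le T : \sum_(1 <= t < T.+1) (root4 t ^+ 3)^-1 <= 4 * root4 T.
Proof.
elim: T => [|T IH]; first by rewrite big_geq// mulr_ge0 ?root4_ge0.
rewrite big_nat_recr//=; apply: le_trans (lerD IH (lexx _)) _.
have a0 : 0 < root4 T.+1 by rewrite root4_gt0.
have b0 := root4_ge0 T.
have ab : root4 T <= root4 T.+1 by rewrite !ler_wsqrtr// ler_nat.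
have pow4 : root4 T.+1 ^+ 4 = root4 T ^+ 4 + 1 by rewrite !root4_pow4 natr1.
move: a0 b0 ab pow4; move: (root4 T.+1) (root4 T) => a b a0 b0 ab pow4.
suff : (a ^+ 3)^-1 <= 4 * (a - b) by lra.
rewrite -[leLHS]mul1r ler_pdivrMr ?exprn_gt0//.
have fact : 1 = (a - b) * (a ^+ 3 + a ^+ 2 * b + a * b ^+ 2 + b ^+ 3).
  by transitivity (a ^+ 4 - b ^+ 4); [rewrite pow4; ring|ring].
have {}a0 := ltW a0.
have b2 : b ^+ 2 <= a ^+ 2 by rewrite lerXn2r.
have b3 : b ^+ 3 <= a ^+ 3 by rewrite lerXn2r.

have -> : 4 * (a - b) * a ^+ 3 = (a - b) * (4 * a ^+ 3) by ring.
rewrite [leLHS]fact ler_wpM2l ?subr_ge0//.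
have H1 : a ^+ 2 * b <= a ^+ 2 * a by rewrite ler_wpM2l ?exprn_ge0.
have H2 : a * b ^+ 2 <= a * a ^+ 2 by rewrite ler_wpM2l.
by move: H1 H2 b3; rewrite -!exprSr -!exprS; lra.
Qed.

Lemma powR_root4 t : t%:R `^ (- (3 / 2)) = (root4 t ^+ 6)^-1.
Proof.
rewrite powRN; congr (_^-1).
have -> : 3 / 2 = 2^-1 * 3 :> R by rewrite mulrC.
by rewrite powRrM powR12_sqrt// powR_mulrn ?sqrtr_ge0// -root4_sqr -exprM.
Qed.
End ScalarSums.

(** * Regret of a run *)

Section Run.
Variables (R : realType) (m d : nat) (N : 'rV[R]_d -> R) (K : set 'rV[R]_d).
Variables (P : nat -> 'M[R]_m) (r w : 'rV[R]_d -> R) (dw : 'rV[R]_d -> 'rV[R]_d).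
Variables (zeta DK Gl Gr sw Gw C : R) (B T : nat).
Variables (l : 'I_m -> nat -> 'rV[R]_d -> R).
Variables (dl : 'I_m -> nat -> 'rV[R]_d -> 'rV[R]_d) (rho : nat -> R).
Variables (x y ystar : 'I_m -> nat -> 'rV[R]_d) (z : 'rV[R]_d).
Let H : R := Num.sqrt T%:R.
Hypotheses (isN : is_norm N) (cK : convex_set K) (cr : convex_function setT r).
Hypothesis network : network_assumption P zeta B.
Hypothesis K_diam : diameter_assumption N K DK.
Hypothesis loss : loss_assumption N K Gl l dl T.
Hypothesis r_lip : lipschitz_over K N Gr r.
Hypothesis mirror : mirror_map_assumption N K w dw sw Gw.
Hypothesis V_convex : bregman_convexity_assumption K w dw.
Hypothesis rho_le : forall t, (1 <= t <= T)%N -> rho t <= C * (root4 R t ^+ 6)^-1.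
Hypothesis run : ODCMD_run K r w dw P dl T H^-1 rho x y ystar.
Hypotheses (Gl_ge0 : 0 <= Gl) (Gr_ge0 : 0 <= Gr) (Gw_ge0 : 0 <= Gw) (C_ge0 : 0 <= C).
Hypotheses (m_gt0 : (0 < m)%N) (T_gt0 : (0 < T)%N) (Kz : K z).

Let sw_gt0 : 0 < sw. Proof. by case: mirror. Qed.
Let H_gt0 : 0 < H. Proof. by rewrite sqrtr_gt0 ltr0n. Qed.
Let H_ge1 : 1 <= H.
Proof. by rewrite -(sqrtr1 R) ler_wsqrtr// (ler_nat R 1). Qed.
Let H_sqr : H ^+ 2 = T%:R. Proof. by rewrite sqr_sqrtr. Qed.
Let eta_gt0 : 0 < H^-1. Proof. by rewrite invr_gt0. Qed.
Let DK_ge0 : 0 <= DK.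
Proof. exact: le_trans (norm_ge0 isN _) (K_diam Kz Kz). Qed.

Lemma iterate_mem i t : (1 <= t <= T.+1)%N -> K (x i t).
Proof.
have [init rounds] := run; case: t => // -[_|t tT]; first by case: (init i).
have [|_ _ _ ->] := rounds i t.+1; first by lia.
have [ds _ _] := network; have [P0 Pr _] := ds t.+1 isT.
apply: convex_set_sum => // j.
by have [|_ ? _ _] := rounds j t.+1; first by lia.
Qed.

Let G : R := Gl + Gr.
Let c : R := Num.sqrt (4 * C / sw).

(** Quadratic growth turns the accuracy of the subproblems, of order t^(-3/2),
    into a distance of order T^(-1/4) t^(-3/4), whose sum over t is bounded. *)
Lemma inexactness_le i t : (1 <= t <= T)%N ->
  N (y i t - ystar i t) <= c * (root4 R T)^-1 * (root4 R t ^+ 3)^-1.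
Proof.
move=> tT; have [_ /(_ i t tT)[ys_min Ky near _]] := run.
have t0 : 0 < root4 R t by apply: root4_gt0; case/andP: tT.
have T0 : 0 < root4 R T by exact: root4_gt0.
have := subproblem_growth isN cK cr mirror eta_gt0 ys_min Ky.
have := rho_le tT; set n := N _ => rhot growth.
have n0 : 0 <= n by exact: norm_ge0.
have n2 : n ^+ 2 <= 4 * C / sw * (root4 R T ^+ 2)^-1 * (root4 R t ^+ 6)^-1.
  have : sw / (4 * H^-1) * n ^+ 2 <= C * (root4 R t ^+ 6)^-1 by lra.
  have -> : sw / (4 * H^-1) = (4 / (sw * H))^-1.
    by field; rewrite !gt_eqF.
  rewrite ler_pdivrMl ?divr_gt0 ?mulr_gt0// root4_sqr -/H => h.
  apply: le_trans h _; rewrite le_eqVlt; apply/orP; left; apply/eqP.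
  by field; rewrite !gt_eqF.
rewrite -(ler_pXn2r (n := 2))// ?nnegrE; last first.
  by rewrite !mulr_ge0 ?sqrtr_ge0// ?invr_ge0 ?exprn_ge0 ?(ltW t0) ?(ltW T0).
apply: le_trans n2 _.
have c2 : c ^+ 2 = 4 * C / sw by rewrite sqr_sqrtr// divr_ge0 ?mulr_ge0// ltW.
by rewrite 2!exprMn c2 !exprVn -exprM.
Qed.

Lemma sum_inexactness_le :
  \sum_(1 <= t < T.+1) \sum_i N (y i t - ystar i t) <= m%:R * (4 * c).
Proof.
have T0 : 0 < root4 R T by exact: root4_gt0.
apply: (@le_trans _ _ (\sum_(1 <= t < T.+1)
    m%:R * (c * (root4 R T)^-1) * (root4 R t ^+ 3)^-1)).
  apply: ler_sum_nat => t tT.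
  apply: (@le_trans _ _ (\sum_(i < m) c * (root4 R T)^-1 * (root4 R t ^+ 3)^-1)).
    by apply: ler_sum => i _; exact: inexactness_le.
  by rewrite sumr_const card_ord -[leLHS]mulr_natl !mulrA.
rewrite -mulr_sumr; apply: le_trans (ler_wpM2l _ (sum_root4_le R T)) _.
  by rewrite !mulr_ge0 ?sqrtr_ge0// invr_ge0 ltW.
by rewrite le_eqVlt; apply/orP; left; apply/eqP; field; rewrite gt_eqF.
Qed.

Lemma sum_local_step_le :
  \sum_(1 <= t < T.+1) \sum_i N (y i t - x i t) <= m%:R * (G / sw + 4 * c) * H.
Proof.
have c0 : 0 <= c by exact: sqrtr_ge0.
apply: (@le_trans _ _ (\sum_(1 <= t < T.+1)
    (m%:R * (H^-1 * G / sw) + \sum_i N (y i t - ystar i t)))).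
  apply: ler_sum_nat => t tT.
  have -> : m%:R * (H^-1 * G / sw) = \sum_(i < m) (H^-1 * G / sw).
    by rewrite sumr_const card_ord mulr_natl.
  rewrite -big_split/=; apply: ler_sum => i _.
  apply: le_trans (norm_triangle isN (ystar i t) _ _) _.
  rewrite [leRHS]addrC lerD2l.
  have [_ /(_ i t tT)[ys_min _ _ _]] := run.
  have Kx : K (x i t) by apply: iterate_mem; lia.
  have [_ _ _ /(_ _ Kx) dl_le] := loss i tT.
  exact: (exact_step_le isN cK cr mirror eta_gt0 ys_min).
rewrite big_split/= sumr_const_nat subn1 /= -[X in X + _]mulr_natl -H_sqr.
have -> : m%:R * (G / sw + 4 * c) * H =
   H ^+ 2 * (m%:R * (H^-1 * G / sw)) + m%:R * (4 * c) * H.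
  by field; rewrite !gt_eqF.
rewrite lerD2l; apply: le_trans sum_inexactness_le _.
by rewrite ler_peMr// !mulr_ge0.
Qed.

(** Convexity of the divergence in its second argument makes its sum over the
    nodes nonincreasing under averaging, so it serves as potential. *)
Lemma sum_bregman_mix_le t : (1 <= t <= T)%N ->
  \sum_i bregman w dw z (x i t.+1) <= \sum_i bregman w dw z (y i t).
Proof.
move=> tT; have [_ rounds] := run; have [ds _ _] := network.
have [|P0 Pr Pc] := ds t; first by lia.
apply: (@le_trans _ _ (\sum_i \sum_j P t i j * bregman w dw z (y j t))).
  apply: ler_sum => i _; have [_ _ _ ->] := rounds i t tT.
  by apply: V_convex => // j; have [] := rounds j t tT.
rewrite exchange_big/=; apply: ler_sum => j _.
by rewrite -mulr_suml Pc mul1r.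
Qed.

Lemma sum_bregman_telescope :
  \sum_(1 <= t < T.+1)
    \sum_i (bregman w dw z (x i t) - bregman w dw z (y i t)) <=
  m%:R * (Gw * DK ^+ 2).
Proof.
pose V t := \sum_i bregman w dw z (x i t).
apply: (@le_trans _ _ (\sum_(1 <= t < T.+1) (- V t.+1 - - V t))).
  apply: ler_sum_nat => t tT; rewrite opprK addrC sumrB.
  by rewrite lerD2l lerN2 sum_bregman_mix_le.
rewrite telescope_sumr// opprK addrC.
have V1 : V 1%N <= m%:R * (Gw * DK ^+ 2).
  have -> : m%:R * (Gw * DK ^+ 2) = \sum_(i < m) (Gw * DK ^+ 2).
    by rewrite sumr_const card_ord mulr_natl.
  apply: ler_sum => i _; have Kx : K (x i 1%N) by exact: iterate_mem.
  apply: le_trans (bregman_le isN mirror Kz Kx) _.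
  by rewrite ler_wpM2l// lerXn2r ?nnegrE ?norm_ge0 ?K_diam.
have VT : 0 <= V T.+1.
  apply: sumr_ge0 => i _; have Kx : K (x i T.+1) by apply: iterate_mem; lia.
  apply: le_trans (bregman_ge mirror Kz Kx).
  by rewrite mulr_ge0 ?sqr_ge0// divr_ge0// ltW.
by move: V1 VT; lra.
Qed.

Let own_loss_rate : R := m%:R * (Gw * DK ^+ 2 + G ^+ 2 / (2 * sw) + 8 * Gw * DK * c).

(** Convexity replaces the losses by their linearizations, to which the bound
    of a single step applies.  Its divergence terms telescope; its other terms
    contribute T H^-1 = H and H times the bounded sum of the inexactness. *)
Lemma sum_own_loss_le :
  \sum_(1 <= t < T.+1) \sum_i
    (l i t (x i t) + r (x i t) - (l i t z + r z)) <= own_loss_rate * H.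
Proof.
apply: (@le_trans _ _ (\sum_(1 <= t < T.+1)
   (H * \sum_i (bregman w dw z (x i t) - bregman w dw z (y i t))
    + m%:R * (H^-1 * G ^+ 2 / (2 * sw))
    + 2 * Gw * DK * H * \sum_i N (y i t - ystar i t)))).
  apply: ler_sum_nat => t tT.
  have -> : m%:R * (H^-1 * G ^+ 2 / (2 * sw)) =
    \sum_(i < m) (H^-1 * G ^+ 2 / (2 * sw)) by rewrite sumr_const card_ord mulr_natl.
  rewrite !mulr_sumr -!big_split/=; apply: ler_sum => i _.
  have [_ /(_ i t tT)[ys_min Ky _ _]] := run.
  have Kx : K (x i t) by apply: iterate_mem; lia.
  have [_ sub _ /(_ _ Kx) dl_le] := loss i tT.
  have := step_regret isN cK cr mirror eta_gt0 ys_min Gw_ge0 Kx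
    dl_le r_lip K_diam Ky Kz.
  have := sub _ Kx z I; rewrite invrK !dotpE.
  by rewrite -/G; lra.
rewrite !big_split/= sumr_const_nat subn1 /=.
rewrite -[X in _ + X + _]mulr_natl -H_sqr -!mulr_sumr.
have -> : own_loss_rate * H = H * (m%:R * (Gw * DK ^+ 2))
    + H ^+ 2 * (m%:R * (H^-1 * G ^+ 2 / (2 * sw)))
    + 2 * Gw * DK * H * (m%:R * (4 * c)).
  by rewrite /own_loss_rate; field; rewrite !gt_eqF.
rewrite lerD//; last by rewrite ler_wpM2l ?sum_inexactness_le// !mulr_ge0// ltW.
by rewrite lerD2r ler_wpM2l ?sum_bregman_telescope// ltW.
Qed.

Let L := (m.+1 * B)%N.
Let contraction : R := m%:R * zeta ^+ L.
Let disagreement_rate :=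
  (L%:R * (m%:R * DK) + 2 * L%:R * (m%:R * (G / sw + 4 * c))) / contraction.

Lemma contraction_gt0 : 0 < contraction.
Proof. by have [_ [z0 _] _] := network; rewrite mulr_gt0 ?exprn_gt0 ?ltr0n. Qed.

Lemma contraction_le1 : contraction <= 1.
Proof.
have [_ Pr _] := transition_doubly_stochastic network L (isT : (0 < 1)%N).
rewrite -(Pr (Ordinal m_gt0)) /contraction.
have -> : m%:R * zeta ^+ L = \sum_(i < m) zeta ^+ L.
  by rewrite sumr_const card_ord mulr_natl.
by apply: ler_sum => j _; exact: transition_ge.
Qed.

Lemma sum_disagreement_le :
  \sum_(1 <= t < T.+1) disagreement N (x^~ t) <= disagreement_rate * H.
Proof.
have [_ rounds] := run.
have mD0 : 0 <= m%:R * DK by rewrite mulr_ge0.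
rewrite /disagreement_rate mulrAC ler_pdivlMr ?contraction_gt0// mulrC.
apply: le_trans (sum_contraction_le (T := T) (L := L) (D := m%:R * DK)
  (v := fun t => disagreement N (x^~ t))
  (e := fun t => \sum_i N (y i t - x i t)) _ _ _ contraction_le1 _ _) _ => //.
- by move=> t; exact: disagreement_ge0.
- by move=> t; apply: sumr_ge0 => i _; exact: norm_ge0.
- move=> t tT; apply: (disagreement_le_diameter m_gt0 cK K_diam) => i.
  by apply: iterate_mem; lia.
- move=> s s0 sT; apply: (disagreement_window network) => // t i st.
  by have [|_ _ _ ->] := rounds i t; first by lia.
rewrite [leRHS]mulrDl lerD//.
  by rewrite ler_peMr// mulr_ge0.
by rewrite -[leRHS]mulrA ler_wpM2l ?mulr_ge0// sum_local_step_le.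
Qed.

Lemma sum_consensus_gap_le (j : 'I_m) :
  \sum_(1 <= t < T.+1) \sum_i
    (l i t (x j t) + r (x j t) - (l i t (x i t) + r (x i t))) <=
  G * (m%:R + 1) * disagreement_rate * H.
Proof.
have G0 : 0 <= G by rewrite addr_ge0.
apply: (@le_trans _ _ (\sum_(1 <= t < T.+1)
   G * (m%:R + 1) * disagreement N (x^~ t))).
  apply: ler_sum_nat => t tT.
  apply: (@le_trans _ _ (\sum_i G * N (x j t - x i t))); last first.
    by rewrite -mulr_sumr -mulrA ler_wpM2l// sum_dist_le.
  apply: ler_sum => i _.
  have Kx k : K (x k t) by apply: iterate_mem; lia.
  have [_ _ l_lip _] := loss i tT.
  have := le_trans (ler_norm _) (l_lip _ _ (Kx j) (Kx i)).
  have := le_trans (ler_norm _) (r_lip (Kx j) (Kx i)).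
  by rewrite /G; lra.
by rewrite -mulr_sumr -[leRHS]mulrA ler_wpM2l ?sum_disagreement_le// mulr_ge0 ?addr_ge0.
Qed.

(** Stated explicitly to make its independence of T and of the losses apparent. *)
Definition regret_constant : R :=
  own_loss_rate + G * (m%:R + 1) * disagreement_rate.

Lemma avg_regret_le (j : 'I_m) :
  avg_regret r l T x z j <= regret_constant * H^-1.
Proof.
rewrite /avg_regret -mulrBr ler_pdivrMl ?ltr0n// -H_sqr.
have -> : H ^+ 2 * (regret_constant * H^-1) = regret_constant * H.
  by field; rewrite gt_eqF.
rewrite /regret_constant mulrDl.
apply: le_trans (lerD sum_own_loss_le (sum_consensus_gap_le j)).
rewrite /cumulative_loss -sumrB -big_split/= le_eqVlt; apply/orP; left; apply/eqP.
apply: eq_bigr => t _; rewrite -sumrB -big_split/=.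
by apply: eq_bigr => i _; ring.
Qed.
End Run.

Unset Implicit Arguments.
Set Strict Implicit.

Theorem corollary1 (R : realType) (m d : nat) (N : 'rV[R]_d -> R)
    (K : set 'rV[R]_d) (P : nat -> 'M[R]_m)
    (r w : 'rV[R]_d -> R) (dw : 'rV[R]_d -> 'rV[R]_d)
    (zeta DK Gl Gr sw Gw : R) (B : nat)
    (l : nat -> 'I_m -> nat -> 'rV[R]_d -> R)
    (dl : nat -> 'I_m -> nat -> 'rV[R]_d -> 'rV[R]_d)
    (rho : nat -> nat -> R)
    (x y ystar : nat -> 'I_m -> nat -> 'rV[R]_d)
    (xstar : nat -> 'rV[R]_d) :
  is_norm N ->
  convex_set K ->
  convex_function setT r ->
  network_assumption P zeta B ->
  diameter_assumption N K DK ->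
  (forall T, (1 <= T)%N -> loss_assumption N K Gl (l T) (dl T) T) ->
  lipschitz_over K N Gr r ->
  mirror_map_assumption N K w dw sw Gw ->
  bregman_convexity_assumption K w dw ->
  (forall T t, (1 <= t <= T)%N -> 0 <= rho T t) ->
  (exists Crho : R, forall T t, (1 <= t <= T)%N ->
     rho T t <= Crho * t%:R `^ (- (3 / 2))) ->
  (forall T, (1 <= T)%N ->
     ODCMD_run K r w dw P (dl T) T (Num.sqrt T%:R)^-1 (rho T)
       (x T) (y T) (ystar T)) ->
  (forall T, (1 <= T)%N ->
     is_argmin K (fun z => cumulative_loss r (l T) T (fun=> z)) (xstar T)) ->
  exists C : R, forall T (j : 'I_m), (1 <= T)%N ->
    avg_regret r (l T) T (x T) (xstar T) j <= C * (Num.sqrt T%:R)^-1.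
Proof.
move=> isN cK cr network K_diam loss r_lip mirror V_convex _ [Crho rho_le] run xstar_min.
have n0 v : 0 <= N v by exact: norm_ge0.
exists (regret_constant m zeta DK `|Gl| `|Gr| sw `|Gw| `|Crho| B) => T j T0.
apply: (@avg_regret_le _ _ _ N K P r w dw _ _ _ _ _ _ _ _ _ _ (dl T) (rho T)
  _ (y T) (ystar T)) => //.
- move=> i t tT; have [l_cvx sub lip dl_le] := loss T T0 i t tT.
  split=> // [u v Ku Kv|u Ku]; last exact: le_trans (dl_le _ Ku) (ler_norm _).
  by apply: le_trans (lip _ _ Ku Kv) _; rewrite ler_wpM2r// ler_norm.
- by move=> u v Ku Kv; apply: le_trans (r_lip _ _ Ku Kv) _; rewrite ler_wpM2r// ler_norm.
- have [sub s0 sc smooth] := mirror; split=> // u v Ku Kv.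
  by apply: le_trans (smooth _ _ Ku Kv) _; rewrite ler_wpM2r// ler_norm.
- move=> t tT; apply: le_trans (rho_le T t tT) _; rewrite powR_root4.
  by rewrite ler_wpM2r ?ler_norm// invr_ge0 exprn_ge0 ?root4_ge0.
- exact: run.
- exact: leq_ltn_trans (leq0n j) (ltn_ord j).
- by have [] := xstar_min T T0.
Qed.
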